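(* Suppose $X$ is a compact Hausdorff space. Then: (1) If $x\in X$, then $x$ is a $\mathfrak{q}$-point if and only if $x$ is not a P-point. (2) If $K\subseteq X$ is compact and every point of $K$ is a P-point of $X$, then $K$ is finite. (3) If $A$ is the set of all $\mathfrak{q}$-points of $X$, then $X\setminus\overline{A}$ is the set of isolated points of $X$.
   Context: $C(X)$ denotes the set of complex-valued continuous functions on $X$. A point $x\in X$ is a P-point of $X$ if every function in $C(X)$ is constant on some open set containing $x$. A point $x\in X$ is a $\mathfrak{q}$-point of $X$ if there is a sequence $\{K_n\}_{n\in\mathbb{N}}$ of pairwise disjoint compact subsets of $X$ such that each $K_n$ is disjoint from the closure of $\bigcup_{m\in\mathbb{N},\,m\neq n}K_m$, and $x\in\overline{\bigcup_{n\in\mathbb{N}}K_n}\setminus\bigcup_{n\in\mathbb{N}}K_n$. *)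

(* Defs.v *)
From mathcomp Require Import all_boot all_order all_algebra.
From mathcomp Require Import complex.
From mathcomp Require Import all_classical all_reals all_analysis.

Set Implicit Arguments.
Unset Strict Implicit.
Unset Printing Implicit Defensive.

Import numFieldNormedType.Exports.

Local Open Scope classical_set_scope.
Local Open Scope complex_scope.

(* [R[i]^o] is the field of complex numbers with the topology of its modulus;
   [R[i]] itself has no canonical topology. *)
Definition P_point (R : realType) (X : topologicalType) (x : X) : Prop :=
  forall f : X -> R[i]^o, continuous f ->
    exists2 U : set X, open_nbhs x U &
      exists c : R[i]^o, forall y, U y -> f y = c.

Definition q_point (X : topologicalType) (x : X) : Prop :=
  exists K : nat -> set X,
    [/\ forall n, compact (K n),
        trivIset [set: nat] K,
        forall n, K n `&` closure (\bigcup_(m in [set m | m <> n]) K m) = set0 &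
        (closure (\bigcup_n K n) `\` \bigcup_n K n) x].

(* Main.v *)
Require Import Defs.
From mathcomp Require Import all_boot all_order all_algebra.
From mathcomp Require Import complex zify.
From mathcomp Require Import all_classical all_reals all_analysis.

(** The key fact is that a P-point [x] never lies in the closure of a countable
    union of closed sets [F n] missing [x]: Urysohn functions [f n] with values
    in [[0, 1]], vanishing at [x] and equal to 1 on [F n], combine into the
    continuous function [sup_n f n / (n + 1)], whose zeros are the common zeros
    of the [f n].  It vanishes at [x], hence near [x], so a whole neighbourhood
    of [x] avoids every [F n] ([P_point_notin_closure_bigcup]).

    Applied to the compact sets of a q-point, this shows that a q-point is not
    a P-point.  Applied to the points of an injective sequence, it shows that an
    infinite compact set contains a point that is not a P-point: take a cluster
    point [p] of the sequence and discard the term equal to [p], if any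
    ([compact_P_points_finite]).

    Conversely, if [x] is not a P-point, there is a continuous [g >= 0] with
    [g x = 0] that takes positive values arbitrarily close to [x].  Near [x] the
    set [g > 0] is covered by the shells [1/(k+2) <= g <= 1/(k+1)], [k >= 1].
    Shells of the same parity are separated from one another by gaps, so each
    parity class is a candidate for the family of a q-point; and since closure
    commutes with finite unions, the union of one of the two classes has [x] in
    its closure ([not_P_q_point]).

    Finally, a point outside the closure of the set of q-points has a closed
    neighbourhood made of P-points; that neighbourhood is finite, so the point
    is isolated, while an isolated point is trivially a P-point. *)

Import Order.TTheory GRing.Theory Num.Theory.
Import numFieldNormedType.Exports.
Import ComplexField.Normc.

Local Open Scope classical_set_scope.
Local Open Scope ring_scope.

(** * Continuity between the reals and the complex numbers *)

Lemma continuous_real_complex (R : realType) (X : topologicalType)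
    (g : X -> R) :
  continuous g -> continuous (fun y => (g y)%:C%C : R[i]^o).
Proof.
move=> cg x; apply/cvgrPdist_lt => e e0.
(* A positive element of the ordered field of complex numbers is real. *)
have eE : e = (complex.Re e)%:C%C by rewrite RRe_real// gtr0_real.
have Re0 : 0 < complex.Re e by move: e0; rewrite eE ltcR.
have /cvgrPdist_lt/(_ _ Re0) := cg x.
apply: filterS => y; rewrite eE -rmorphB/= normc_def/= expr0n addr0 sqrtr_sqr.
by rewrite ltcR.
Qed.

Lemma continuous_normc (R : realType) (X : topologicalType)
    (f : X -> R[i]^o) :
  continuous f -> continuous (fun y => normc (f y)).
Proof.
move=> cf x; apply/cvgrPdist_lt => e e0.
have e0C : 0 < e%:C%C :> R[i] by rewrite ltcR.
have /cvgrPdist_lt/(_ _ e0C) := cf x.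
apply: filterS => y; rewrite -ltcR; apply: le_lt_trans.
have normcE z : (normc z)%:C%C = `|z| :> R[i] by case: z.
have -> : `|normc (f x) - normc (f y)|%:C%C =
    `| `|f x : R[i]| - `|f y : R[i]| |.
  by rewrite -!normcE -rmorphB/= expr0n addr0 sqrtr_sqr.
exact: ler_dist_dist.
Qed.

(** Real-valued functions suffice to test P-points: a complex function [f] is
    constant near [x] as soon as the modulus of [f - f x] vanishes near [x]. *)
Lemma P_pointP (R : realType) (X : topologicalType) (x : X) :
  P_point R x <->
  (forall g : X -> R, continuous g -> \forall y \near x, g y = g x).
Proof.
split=> [Px g cg|Px f cf].
  have [U Uo [c Uc]] := Px _ (continuous_real_complex _ _ _ cg).
  apply: filterS (open_nbhs_nbhs Uo) => y Uy; have [_ Ux] := Uo.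
  by have [] := etrans (Uc _ Uy) (esym (Uc _ Ux)).
have cg : continuous (fun y => normc (f y - f x)).
  apply: continuous_normc => y.
  by apply: cvgB; [exact: cf|exact: cvg_cst].
have : nbhs x [set y | normc (f y - f x) = normc (f x - f x)] := Px _ cg.
rewrite nbhsE => -[U oU Ug].
exists U => //; exists (f x) => y /Ug/=.
by rewrite subrr normc0 => /eq0_normc/eqP; rewrite subr_eq0 => /eqP.
Qed.

(** * A continuous function whose zeros are the common zeros of a sequence *)

Section weighted_sup.
Context {R : realType} {X : topologicalType} (f : nat -> X -> R).
Hypothesis f_cont : forall n, continuous (f n).
Hypothesis f_itv : forall n y, 0 <= f n y <= 1.

(** Plays the role of a weighted series: dividing by [n + 1] makes the tail of
    the sequence uniformly small, which is all that continuity requires, and a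
    supremum involves no convergence of partial sums. *)
Definition weighted_sup (y : X) : R := sup (range (fun n => f n y / n.+1%:R)).

Lemma weighted_sup_ub n y : f n y / n.+1%:R <= weighted_sup y.
Proof.
apply: ub_le_sup; last by exists n.
exists 1 => _ [m _ <-]; rewrite ler_pdivrMr// mul1r.
by have /andP[_ /le_trans->//] := f_itv m y; rewrite ler1n.
Qed.

Lemma weighted_sup_le y c :
  (forall n, f n y / n.+1%:R <= c) -> weighted_sup y <= c.
Proof.
move=> fc; apply: ge_sup; first by exists (f 0 y / 1%:R), 0.
by move=> _ [n _ <-].
Qed.

(** Up to [e], only the finitely many indices [n < N] matter, where
    [1/(N+1) <= e], and finitely many continuous functions vary by at most [e]
    on a common neighbourhood. *)
Lemma weighted_sup_continuous : continuous weighted_sup.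
Proof.
move=> x; apply/cvgrPdist_le => e e0.
near \oo => N.
have Ne : N.+1%:R^-1 <= e.
  by apply/ltW; near: N; exact: (near_infty_natSinv_lt (PosNum e0)).
have fxy : \forall y \near x, forall n, (n < N)%N -> `|f n x - f n y| <= e.
  pose A n := [set y | `|f n x - f n y| <= e].
  have : \forall y \near x, forall i : 'I_N, A i y.
    apply: filter_forall => i.
    by have /cvgrPdist_le/(_ _ e0) := f_cont i x.
  by apply: filterS => y Ay n nN; exact: (Ay (Ordinal nN)).
have step u v : (forall n, (n < N)%N -> f n u <= f n v + e) ->
    weighted_sup u <= weighted_sup v + e.
  move=> uv; apply: weighted_sup_le => n.
  have [nN|Nn] := ltnP n N.
    apply: le_trans (lerD (weighted_sup_ub n v) (lexx e)).
    rewrite (le_trans (ler_pM _ _ (uv _ nN) (lexx _)))//.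
    - by have /andP[] := f_itv n u.
    - by rewrite mulrDl lerD2l ler_pdivrMr// ler_pMr// ler1n.
  rewrite -[X in X <= _]add0r lerD//.
    apply: le_trans (weighted_sup_ub 0 v).
    by have /andP[? _] := f_itv 0 v; rewrite divr_ge0.
  apply: le_trans Ne.
  apply: (@le_trans _ _ n.+1%:R^-1).
    by have /andP[_ ?] := f_itv n u; rewrite ler_piMl.
  by rewrite lef_pV2 ?posrE// ler_nat.
apply: filterS fxy => y fxy.
rewrite ler_distlC lerBlDr; apply/andP; split; apply: step => n /fxy;
  by rewrite ler_distlC lerBlDr => /andP[].
Unshelve. all: by end_near. Qed.

Lemma weighted_sup_eq0 y : weighted_sup y = 0 <-> forall n, f n y = 0.
Proof.
split=> [s0 n|f0].
  have := weighted_sup_ub n y; rewrite s0 pmulr_lle0 ?invr_gt0// => fn0.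
  by apply/eqP; rewrite eq_le fn0; have /andP[] := f_itv n y.
apply/eqP; rewrite eq_le weighted_sup_le/=; last first.
  by move=> n; rewrite f0 mul0r.
by rewrite -[X in X <= _](mul0r (1%:R^-1)) -(f0 0) (weighted_sup_ub 0).
Qed.

End weighted_sup.

(** * P-points and q-points of a compact Hausdorff space *)

Section compact_hausdorff.
Context {R : realType} {X : topologicalType}.
Hypothesis hX : compact [set: X].
Hypothesis hausX : hausdorff_space X.

Lemma closed_set_compact (A : set X) : closed A -> compact A.
Proof. by move=> cA; exact: subclosed_compact cA hX _. Qed.

(** Equivalently, a countable intersection of open neighbourhoods of a P-point is
    a neighbourhood of it, the open sets being the complements of the [F n]. *)
Lemma P_point_notin_closure_bigcup (x : X) (F : nat -> set X) :
  P_point R x -> (forall n, closed (F n)) -> (forall n, ~ F n x) ->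
  ~ closure (\bigcup_n F n) x.
Proof.
move=> /P_pointP Px cF nFx.
have clx : closed [set x].
  exact/accessible_closed_set1/hausdorff_accessible.
have sep n : exists f : X -> R, [/\ continuous f,
    forall y, 0 <= f y <= 1, f x = 0 & forall y, F n y -> f y = 1].
  have xF0 : [set x] `&` F n = set0.
    by apply/seteqP; split=> // y [-> /nFx].
  have nX : normal_space X := compact_normal hausX hX.
  have := (@normal_separatorP R X).1 nX _ _ clx (cF n) xF0.
  move=> /(@uniform_separatorP X R)[f [cf f01 f0 f1]].
  exists f; split=> //.
  - by move=> y; have := f01 (f y) (ex_intro2 _ _ y I erefl); rewrite /= in_itv.
  - by apply: f0; exists x.
  - by move=> y Fy; apply: f1; exists y.
have [f fP] := choice sep.
have cf n : continuous (f n) by have [] := fP n.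
have f01 n y : 0 <= f n y <= 1 by have [_ ->] := fP n.
have wx : weighted_sup f x = 0.
  by apply/weighted_sup_eq0 => // n; have [] := fP n.
have := Px _ (weighted_sup_continuous f cf f01).
rewrite wx => wnear /(_ _ wnear)[y [[n _ Fy] /=]].
move=> /(weighted_sup_eq0 f f01)/(_ n).
have [_ _ _ /(_ y Fy) ->] := fP n.
by move/eqP; rewrite oner_eq0.
Qed.

Lemma q_point_not_P (x : X) : q_point x -> ~ P_point R x.
Proof.
move=> [K [cK _ _ [clx nKx]]] Px.
apply: (P_point_notin_closure_bigcup x K Px _ _ clx).
  by move=> n; exact: compact_closed.
by move=> n Kx; apply: nKx; exists n.
Qed.

(** A cluster point of an injective sequence of [K] is in the closure of the
    countably many terms of the sequence that differ from it. *)
Lemma compact_P_points_finite (K : set X) :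
  compact K -> (forall x, K x -> P_point R x) -> finite_set K.
Proof.
move=> cK KP; apply: contrapT => /infiniteP/card_leP[a].
(* The sequence is built on [nat] and [K] seen as types, because [X] need not
   be pointed. *)
pose b n : X := val (a (to_setT n)).
have bK n : K (b n) by exact: set_valP.
have binj : injective b.
  by move=> m n /val_inj /(inj (in_setT _) (in_setT _)) /(congr1 val).
have bnear : \forall n \near \oo, K (b n) by exact: nearW.
have [p [Kp pcl]] := cK (b @ \oo) _ bnear.
pose F n : set X := [set b n] `\ p.
apply: (P_point_notin_closure_bigcup p F (KP _ Kp)).
- move=> n; have /accessible_finite_set_closed := @hausdorff_accessible X hausX.
  by apply; exact: finite_setD.
- by move=> n [_ /(_ erefl)].
- move=> U Up.
  have bNp : \forall n \near \oo, b n <> p.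
    have [[m bm]|nb] := pselect (exists m, b m = p).
      exists m.+1 => // n /= mn bn; move: mn.
      by rewrite (binj n m) ?ltnn// bn bm.
    by apply: nearW => n bn; apply: nb; exists n.
  have bNp' : \forall n \near \oo, (b @` [set n | b n <> p]) (b n).
    by apply: filterS bNp => n bn; exists n.
  have [y [[n bNpn yE] Uy]] := pcl _ U bNp' Up.
  exists y; split=> //; exists n => //; split; first by rewrite /= yE.
  by rewrite -yE.
Qed.

(** The open shell [u (2n+3) < g < u (2n)] contains the [n]-th closed shell and
    misses all the others, so its complement contains the closure of their
    union.  The indices start at 1, leaving [u 0] as an upper bound for the open
    shell around the outermost closed one. *)
Lemma q_point_shells (g : X -> R) (u : nat -> R) (x : X) :
  continuous g -> decreasing_seq u -> (forall n, 0 < u n) -> g x = 0 ->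
  closure (\bigcup_n g @^-1` `[u n.*2.+2, u n.*2.+1]) x -> q_point x.
Proof.
move=> cg du u0 gx clx.
pose K n := g @^-1` `[u n.*2.+2, u n.*2.+1].
have ult m n : (u m < u n) = (n < m)%N by rewrite ltNge du -ltnNge.
have Kcl n : K n `&` closure (\bigcup_(m in [set m | m <> n]) K m) = set0.
  pose C := g @^-1` (~` `]u n.*2.+3, u n.*2[).
  have cC : closed C.
    apply: preimage_closed; first by move=> y _; exact: cg.
    by apply: open_closedC; exact: interval_open.
  have KC : \bigcup_(m in [set m | m <> n]) K m `<=` C.
    move=> y [m /= mn]; rewrite /K /C /= !in_itv/=.
    move=> /andP[uy yu] /andP[uny ynu].
    have := le_lt_trans uy ynu; have := lt_le_trans uny yu.
    rewrite !ult; lia.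
  apply/seteqP; split=> // y [Ky]; move/(closureS KC)/cC; apply.
  move: Ky; rewrite /K /= !in_itv/= => /andP[uy yu].
  by rewrite (lt_le_trans _ uy) ?ult// (le_lt_trans yu) ?ult.
exists K; split=> //.
- move=> n; apply: closed_set_compact.
  apply: preimage_closed; first by move=> y _; exact: cg.
  exact: interval_closed.
(* Disjointness from the closure of the other shells is stronger. *)
- apply/trivIsetP => i j _ _ ij; apply/seteqP; split=> // y [Ky Kjy].
  rewrite -(Kcl i); split=> //; apply: subset_closure; exists j => //=.
  by apply/eqP; rewrite eq_sym.
- split=> // -[n _]; rewrite /K /= in_itv/= gx => /andP[].
  by rewrite leNgt u0.
Qed.

(** Consecutive shells of [g] share a boundary level, so they are not separated
    from one another; splitting them by parity restores the gaps, and [x] stays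
    in the closure of at least one of the two halves. *)
Lemma not_P_q_point (x : X) : ~ P_point R x -> q_point x.
Proof.
move=> nPx.
have [g [cg gx gN]] : exists g : X -> R, [/\ continuous g, g x = 0 &
    forall U, nbhs x U -> exists2 y, U y & 0 < g y].
  have /existsNP[g /not_implyP[cg gN]] :
    ~ forall g : X -> R, continuous g -> \forall y \near x, g y = g x.
    by move/P_pointP.
  exists (fun y => `|g y - g x|); split.
  - move=> y; apply: cvg_norm.
    by apply: (@cvgB _ R^o); [exact: cg|exact: cvg_cst].
  - by rewrite subrr normr0.
  - move=> U Ux; apply: contrapT => /forall2NP gU; apply: gN.
    apply: filterS Ux => y Uy; have [//|/negP] := gU y.
    by rewrite normr_gt0 negbK subr_eq0 => /eqP.
pose u n : R := n.+1%:R^-1.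
have du : decreasing_seq u.
  by move=> m n; rewrite /u lef_pV2 ?posrE// ler_nat ltnS.
have u0 n : 0 < u n by rewrite /u.
have du1 : decreasing_seq (fun n => u n.+1).
  by move=> m n; rewrite du ltnS.
pose K n := g @^-1` `[u n.*2.+2, u n.*2.+1].
pose L n := g @^-1` `[u n.*2.+3, u n.*2.+2].
(* Near [x] the bound [g < u 1] holds, so the least [k] with [u k <= g y] is at
   least 2 and [g y] lies between [u k] and [u (k - 1)]; the parity of [k]
   selects the family. *)
have : closure ((\bigcup_n K n) `|` (\bigcup_n L n)) x.
  move=> U Ux.
  have [|y [Uy gyu] gy] := gN (U `&` [set y | g y < u 1]).
    apply: filterI => //; have /cvgrPdist_lt/(_ _ (u0 1)) := cg x.
    apply: filterS => y; rewrite gx sub0r normrN.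
    by apply: le_lt_trans; exact: ler_norm.
  have [k uk] : exists k, u k <= g y.
    near \oo => k; exists k; apply/ltW; near: k.
    exact: (near_infty_natSinv_lt (PosNum gy)).
  have exk : exists k, u k <= g y by exists k.
  case: (ex_minnP exk) => -[|[|j]] uj jmin.
  - by have := le_lt_trans uj gyu; rewrite ltNge du.
  - by have := le_lt_trans uj gyu; rewrite ltxx.
  have ygu : g y <= u j.+1.
    by apply/ltW; rewrite ltNge; apply/negP => /jmin; rewrite ltnn.
  exists y; split=> //; move: uj ygu; rewrite -(odd_double_half j).
  by case: (odd j) => uj ygu; [right|left]; exists j./2 => //=;
    rewrite ?/K ?/L /= in_itv/= uj ygu.
rewrite closureU => -[]; first exact: q_point_shells.
exact: (q_point_shells g (fun n => u n.+1) x cg du1).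
Unshelve. all: by end_near. Qed.

Lemma isolated_P_point (x : X) : isolated [set: X] x -> P_point R x.
Proof.
move=> [_ [V Vx]]; rewrite setIT => VE; apply/P_pointP => g _.
by move: Vx; rewrite VE; apply: filterS => _ ->.
Qed.

(** By regularity [x] has a closed neighbourhood made of P-points; being compact
    it is finite, and its other points can be removed. *)
Lemma P_points_nbhs_isolated (x : X) :
  (\forall y \near x, P_point R y) -> isolated [set: X] x.
Proof.
move=> /(compact_regular hausX hX filterT)[V Vx clVP].
split; first exact: in_setT.
have finV : finite_set V.
  apply: sub_finite_set (@subset_closure _ V) _.
  apply: compact_P_points_finite clVP.
  exact/closed_set_compact/closed_closure.
have clV : closed (V `\ x).
  have /accessible_finite_set_closed := @hausdorff_accessible X hausX.
  by apply; exact: finite_setD.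
exists (V `\` (V `\ x)).
  apply: filterI => //; apply: open_nbhs_nbhs; split; first exact: closed_openC.
  by move=> [_ /(_ erefl)].
apply/seteqP; split=> [y [[Vy nVy] _]|_ ->].
  by apply: contrapT => yx; apply: nVy.
by split=> //; split; [exact: nbhs_singleton|move=> [_ /(_ erefl)]].
Qed.

End compact_hausdorff.

Theorem lemma3 (R : realType) (X : topologicalType)
    (hX : compact [set: X]) (hausX : hausdorff_space X) :
  [/\ forall x : X, q_point x <-> ~ P_point R x,
      forall K : set X, compact K -> (forall x, K x -> P_point R x) ->
        finite_set K &
      ~` closure [set x : X | q_point x] = isolated [set: X]].
Proof.
have qP (x : X) : q_point x <-> ~ P_point R x.
  by split; [exact: q_point_not_P|exact: not_P_q_point].
split=> //; first exact: compact_P_points_finite.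
apply/seteqP; split=> x.
  move=> nclx; apply: (@P_points_nbhs_isolated R) => //.
  have : nbhs x (~` closure [set x | q_point x]).
    apply: open_nbhs_nbhs; split=> //.
    exact/closed_openC/closed_closure.
  apply: filterS => y ncly; apply: contrapT => /qP qy.
  exact/ncly/subset_closure.
move=> isox clx; have [_ [V Vx]] := isox; rewrite setIT => VE.
have [y [qy]] := clx V Vx; rewrite VE => yx.
by move/qP: qy; apply; rewrite yx; exact: isolated_P_point.
Qed.
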